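(* For real $y\ge 0$ let $L(y)=\{x\in[0,1]:T(x)=y\}$ and $L_0(y)=L(y)\cap[0,\tfrac12]$, where $T$ is the Takagi function. Then: (i) For each $y\geq 0$, $|L(y)|=2|L_0(y)|$. (ii) If $y\in I_k$ for some $k\ge3$, then $$|L_0(y)|=|L_0(\Psi(y))|+\sum_{j=0}^\infty|L(4^j\Phi(y))|.$$ (iii) If $y\in I_2$, then $$|L_0(y)|=\sum_{j=0}^\infty|L(4^j\Phi(y))|.$$
   Context: Let $\phi(x)=\operatorname{dist}(x,\mathbb{Z})$; the Takagi function is $T(x)=\sum_{n=0}^\infty 2^{-n}\phi(2^nx)$. Its range on $[0,1]$ is $[0,\frac23]$, so $L(y)=\emptyset$ for $y>\frac23$. $|A|$ denotes the cardinality of $A$, valued in $\{0,1,2,\dots,\infty\}$ (with $|A|=\infty$ for every infinite set, so equalities may take the form $\infty=\infty$). Let $t_k=k/2^k$ for $k\in\mathbb{N}$, $I_2=[\frac12,\frac23]$, and $I_k=[t_k,t_{k-1})$ for $k\ge3$. Thus $[0,\frac23]$ is the disjoint union of $\{0\}$ and the $I_k$, $k\ge 2$. Define $\Psi:[0,\frac23]\to[0,\frac23]$ by $\Psi(0)=0$ and $\Psi(y)=4(y-t_k)$ if $y\in I_k$ ($k\ge 2$). Define $\Phi:[0,\infty)\to[0,\infty)$ by $\Phi(0)=0$; $\Phi(y)=4^k(y-t_k)$ if $y\in I_k$ with $k\ge3$; $\Phi(y)=4(y-\frac12)$ if $y\ge\frac12$. *)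

(* Defs.v *)
From HB Require Import structures.
From mathcomp Require Export all_boot all_order all_algebra.
From mathcomp Require Export all_classical all_reals all_analysis.

Set Implicit Arguments.
Unset Strict Implicit.
Unset Printing Implicit Defensive.

Import Order.TTheory GRing.Theory Num.Theory.
Import numFieldNormedType.Exports.

Local Open Scope classical_set_scope.
Local Open Scope ring_scope.

Section Takagi.
Variable R : realType.
Implicit Types (x y : R) (k : nat).

Definition dist_int x : R := inf [set `|x - m%:~R| | m in [set: int]].

Definition takagi x : R :=
  limn (series (fun n : nat => 2 ^- n * dist_int (2 ^+ n * x))).

Definition L y : set R := [set x | 0 <= x <= 1 /\ takagi x = y].

Definition L0 y : set R := L y `&` [set x | 0 <= x <= 1 / 2].

Definition t k : R := k%:R / 2 ^+ k.

(* Only meaningful for k >= 2. *)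
Definition I k : set R :=
  if k == 2%N then [set y | 1 / 2 <= y <= 2 / 3]
  else [set y | t k <= y < t k.-1].

(* For 0 < y <= 2/3 this is the k >= 2 with y in I k, which is unique by
   I_disjoint; it has a default value elsewhere. *)
Definition Iindex y : nat := xget 0%N [set k | (2 <= k)%N /\ I k y].

(* Psi has domain [0, 2/3] and Phi has domain [0, +oo[; outside these the
   values are irrelevant. *)
Definition Psi y : R := if y == 0 then 0 else 4 * (y - t (Iindex y)).

Definition Phi y : R :=
  if y == 0 then 0
  else if 1 / 2 <= y then 4 * (y - 1 / 2)
  else 4 ^+ (Iindex y) * (y - t (Iindex y)).

Lemma t2E : t 2 = 1 / 2.
Proof. by rewrite /t expr2 invfM mulrA mulfV ?pnatr_eq0. Qed.

Lemma t_gt0 k : (0 < k)%N -> 0 < t k.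
Proof. by move=> k0; rewrite /t divr_gt0 ?ltr0n// exprn_gt0. Qed.

Lemma t_nincr j k : (0 < j)%N -> (j <= k)%N -> t k <= t j.
Proof.
move=> j0; elim: k => [|k IH]; first by rewrite leqn0 => /eqP <-.
rewrite leq_eqVlt => /predU1P[<-//|]; rewrite ltnS => jk.
apply: le_trans (IH jk); rewrite /t exprS invfM mulrA.
rewrite ler_wpM2r ?invr_ge0 ?exprn_ge0// ler_pdivrMr// -natrM ler_nat.
by rewrite muln2 -addnn -addn1 leq_add2l (leq_trans j0 jk).
Qed.

Lemma I_ge k y : I k y -> t k <= y.
Proof. by rewrite /I; case: eqP => [->|_] /= /andP[]//; rewrite t2E. Qed.

Lemma I_disjoint j k y : (2 <= j)%N -> (2 <= k)%N -> I j y -> I k y -> j = k.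
Proof.
have key i l : (2 <= i)%N -> (i < l)%N -> I i y -> I l y -> False.
  move=> i2 il /I_ge iy; rewrite /I gtn_eqF ?(leq_ltn_trans i2)//=.
  move=> /andP[_]; rewrite ltNge => /negP; apply; apply: le_trans iy.
  by apply: t_nincr; [exact: ltnW | case: l il].
move=> j2 k2 jy ky; case: (ltngtP j k) => // [jk|kj].
- by have := key _ _ j2 jk jy ky.
- by have := key _ _ k2 kj ky jy.
Qed.

Lemma IindexE k y : (2 <= k)%N -> I k y -> Iindex y = k.
Proof.
move=> k2 ky; rewrite /Iindex; apply: xget_unique => // j [j2 jy].
exact: (I_disjoint j2 k2 jy ky).
Qed.

Lemma I_gt0 k y : (2 <= k)%N -> I k y -> 0 < y.
Proof. by move=> k2 /I_ge; apply: lt_le_trans; exact/t_gt0/ltnW. Qed.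

Lemma PsiE k y : (2 <= k)%N -> I k y -> Psi y = 4 * (y - t k).
Proof.
by move=> k2 ky; rewrite /Psi gt_eqF ?(I_gt0 k2 ky)// (IindexE k2 ky).
Qed.

Lemma PhiE k y : (3 <= k)%N -> I k y -> Phi y = 4 ^+ k * (y - t k).
Proof.
move=> k3 ky; have k2 := ltnW k3.
rewrite /Phi gt_eqF ?(I_gt0 k2 ky)// (IindexE k2 ky).
move: ky; rewrite /I gtn_eqF//= => /andP[_ yk].
rewrite ifF//; apply/negbTE; rewrite -ltNge -t2E (lt_le_trans yk)//.
by apply: t_nincr => //; case: k k3 {k2 yk}.
Qed.

Lemma Phi_ge_half y : 1 / 2 <= y -> Phi y = 4 * (y - 1 / 2).
Proof.
by move=> y2; rewrite /Phi y2 gt_eqF// (lt_le_trans _ y2)// divr_gt0.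
Qed.

End Takagi.

(* Main.v *)
(* For k >= 1, on [0, 2^-k] near the right end point, T equals t_k plus scaled
   copies: with e = 2^-k, T (e - e^2 z) = t_k + e^2 T z and
   T (e - e^2 (1 + w)) = t_k + e^2 (T w - 2 w) for z, w in [0, 1], while
   T < t_k further to the left.  So the solutions of T x = t_k + e^2 s in
   [0, 2^-k] are counted by |L(s)| + |M(s)|, where M(s) is the level set of
   T w - 2 w.  Splitting [0, 1/2] at 1/4 gives |M(s)| = |L(4s)| + |M(4s)|, hence
   |L(s)| + |M(s)| = sum_j |L(4^j s)|.  For k = 1 this is (iii); for k >= 3 the
   solutions beyond 2^-k are 2^-k + x'/4 with x' in L_0(Psi y), because
   T (2^-k + x'/4) = t_k + T x' / 4, which gives (ii).  The pieces overlap only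
   when s = 0, and then M(0) is infinite and both sides are infinite. *)
Require Import Defs.
From mathcomp Require Import ring lra finmap.
Set Implicit Arguments.
Unset Strict Implicit.
Unset Printing Implicit Defensive.
Import Order.TTheory GRing.Theory Num.Theory.
Import numFieldNormedType.Exports.

Local Open Scope classical_set_scope.
Local Open Scope ring_scope.

(** * Cardinality of disjoint unions and injective images *)

Section counting.
Context {R : realType} {T U : choiceType}.
Local Open Scope ereal_scope.
Implicit Types (A B : set T) (f : T -> U).

Lemma counting_ge0 A : 0 <= counting A :> \bar R.
Proof. by rewrite /counting; case: ifPn; rewrite ?lee_fin ?leey. Qed.

Lemma counting_infinite A : infinite_set A -> counting A = +oo :> \bar R.
Proof. by move=> iA; rewrite /counting asboolF. Qed.

Lemma counting0 : counting (set0 : set T) = 0 :> \bar R.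
Proof. by rewrite /counting asboolT// fset_set0. Qed.

Lemma counting_setU A B : A `&` B = set0 ->
  counting (A `|` B) = counting A + counting B :> \bar R.
Proof.
move=> AB0; have [fA|iA] := pselect (finite_set A); last first.
  rewrite [counting A]counting_infinite// counting_infinite.
    by rewrite addye// gt_eqF// (lt_le_trans _ (counting_ge0 B)).
  by rewrite finite_setU => -[].
have [fB|iB] := pselect (finite_set B); last first.
  rewrite [counting B]counting_infinite// counting_infinite.
    by rewrite addey// gt_eqF// (lt_le_trans _ (counting_ge0 A)).
  by rewrite finite_setU => -[].
rewrite /counting !asboolT ?finite_setU//.
rewrite fset_setU// cardfsU -fset_setI// AB0 fset_set0 cardfs0 subn0.
by rewrite natrD EFinD.
Qed.

Lemma counting_image A f : {in A &, injective f} ->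
  counting (f @` A) = counting A :> \bar R.
Proof.
move=> finj; have fA := eq_finite_set (inj_card_eq finj).
rewrite /counting fA; case: ifPn => // /asboolP finA.
rewrite fset_set_image// card_in_imfset//= => x y.
by rewrite !in_fset_set//; exact: finj.
Qed.

End counting.

(** Every level set below is cut into two affine copies of other level sets; this turns each such
    cut into an equation between counts. *)
Lemma counting_split {R : realType} {T1 T2 U : choiceType} (A : set T1)
    (B : set T2) (C : set U) (f : T1 -> U) (g : T2 -> U) :
  injective f -> injective g ->
  (forall x y, A x -> B y -> f x <> g y) -> C = f @` A `|` g @` B ->
  (counting C = counting A + counting B :> \bar R)%E.
Proof.
move=> fi gi fg ->; rewrite counting_setU ?counting_image//.
- by move=> x y _ _; exact: gi.
- by move=> x y _ _; exact: fi.
- by rewrite -subset0 => _ [[x Ax <-] [y By]] /esym; exact: fg.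
Qed.

(** * Distance to the nearest integer *)

Section takagi.
Context {R : realType}.
Implicit Types x y u v w z s : R.

Lemma dist_int_le x (m : int) : dist_int x <= `|x - m%:~R|.
Proof. by apply: ge_inf; [exists 0 => _ [j _ <-] | exists m]. Qed.

Lemma le_dist_int x b : (forall m : int, b <= `|x - m%:~R|) -> b <= dist_int x.
Proof.
by move=> bx; apply: lb_le_inf => [|_ [m _ <-]//]; exists `|x - 0%:~R|, 0.
Qed.

Lemma dist_int_ge0 x : 0 <= dist_int x.
Proof. exact: le_dist_int. Qed.

Lemma dist_int_small x : 0 <= x <= 1 / 2 -> dist_int x = x.
Proof.
move=> x01; apply/le_anti/andP; split.
  by rewrite (le_trans (dist_int_le x 0))// subr0 ger0_norm//; lra.
apply: le_dist_int => m; case: (lerP m 0) => m0.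
  have : m%:~R <= 0 :> R by rewrite lerz0.
  by move=> ?; rewrite ger0_norm; lra.
have : 1 <= m%:~R :> R by rewrite ler1z.
by move=> ?; rewrite ler0_norm; lra.
Qed.

Lemma dist_int_reflect x (m : int) : dist_int (m%:~R - x) = dist_int x.
Proof.
have le y : dist_int (m%:~R - y) <= dist_int y.
  apply: le_dist_int => j; apply: le_trans (dist_int_le _ (m - j)) _.
  by rewrite intrB (_ : _ - _ = - (y - j%:~R)) ?normrN//; ring.
apply/le_anti; rewrite le/=.
by rewrite -[in leLHS](subKr m%:~R x) le.
Qed.

Lemma dist_int_le_half x : dist_int x <= 1 / 2.
Proof.
have /andP[] := real_floor_itv (num_real x); set m := Num.floor x.
rewrite intrD => mx xm; case: (lerP (x - m%:~R) (1 / 2)) => h.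
  by apply: le_trans (dist_int_le x m) _; rewrite ger0_norm; lra.
apply: le_trans (dist_int_le x (m + 1)) _.
by rewrite intrD ler0_norm; lra.
Qed.

(** The integers near [x] and [2 * x] are read off on each quarter of the unit interval after the
    floor; on the two middle quarters the bounds sum to exactly 1/2. *)
Lemma dist_int2_le x : dist_int x + dist_int (2 * x) / 2 <= 1 / 2.
Proof.
have /andP[] := real_floor_itv (num_real x); set m := Num.floor x.
rewrite intrD => mx xm.
have bnd (i j : int) a b : `|x - i%:~R| <= a -> `|2 * x - j%:~R| <= b ->
    a + b / 2 <= 1 / 2 -> dist_int x + dist_int (2 * x) / 2 <= 1 / 2.
  move=> ia jb ab; have := le_trans (dist_int_le _ _) ia.
  by have := le_trans (dist_int_le _ _) jb; lra.
case: (lerP (x - m%:~R) (1 / 4)) => h1.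
  apply: (bnd m (2 * m) (x - m%:~R) (2 * (x - m%:~R))).
  - by rewrite ger0_norm; lra.
  - by rewrite intrM ger0_norm; lra.
  - by lra.
case: (lerP (x - m%:~R) (1 / 2)) => h2.
  apply: (bnd m (2 * m + 1) (x - m%:~R) (1 - 2 * (x - m%:~R))).
  - by rewrite ger0_norm; lra.
  - by rewrite intrD intrM ler0_norm; lra.
  - by lra.
case: (lerP (x - m%:~R) (3 / 4)) => h3.
  apply: (bnd (m + 1) (2 * m + 1) (1 - (x - m%:~R)) (2 * (x - m%:~R) - 1)).
  - by rewrite intrD ler0_norm; lra.
  - by rewrite intrD intrM ger0_norm; lra.
  - by lra.
apply: (bnd (m + 1) (2 * m + 2) (1 - (x - m%:~R)) (2 - 2 * (x - m%:~R))).
- by rewrite intrD ler0_norm; lra.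
- by rewrite intrD intrM ler0_norm; lra.
- by lra.
Qed.

(** * Convergence, range and functional equations of T *)

Let S x := series (fun n : nat => 2 ^- n * dist_int (2 ^+ n * x)).

Lemma takagi_partialS x n : S x n.+1 = dist_int x + S (2 * x) n / 2.
Proof.
rewrite /S /series /= big_nat_recl//= expr0 invr1 !mul1r; congr +%R.
rewrite mulr_suml; apply: eq_bigr => k _.
by rewrite exprSr invfM -[X in dist_int X]mulrA; ring.
Qed.

(** Two leading terms contribute at most 1/2 and the rest is a quarter of a shorter sum, so 2/3 =
    1/2 + (2/3)/4 is preserved. The conjunction lets the induction advance by two terms. *)
Lemma takagi_partial_le n x : S x n <= 2 / 3 /\ S x n.+1 <= 2 / 3.
Proof.
elim: n x => [|n IH] x.
  rewrite takagi_partialS /S /series/= !big_geq//.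
  by have := dist_int_le_half x; lra.
split; first by have [] := IH x.
rewrite !takagi_partialS; have [+ _] := IH (2 * (2 * x)).
by have := dist_int2_le x; lra.
Qed.

Lemma takagi_partial_ge0 x n : 0 <= S x n.
Proof.
by apply: sumr_ge0 => k _; rewrite mulr_ge0 ?dist_int_ge0// invr_ge0 exprn_ge0.
Qed.

Lemma takagi_partial_cvg x : S x @ \oo --> takagi x.
Proof.
have : cvgn (S x); last by [].
apply: nondecreasing_is_cvgn.
  apply/nondecreasing_seqP => n.
  rewrite /S seriesSr lerDl.
  by rewrite mulr_ge0 ?dist_int_ge0// invr_ge0 exprn_ge0.
by exists (2 / 3) => _ [n _ <-]; have [] := takagi_partial_le n x.
Qed.

Lemma takagi_ge0 x : 0 <= takagi x.
Proof.
apply: limr_ge; first by apply: cvgP; exact: takagi_partial_cvg.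
by near=> n; exact: takagi_partial_ge0.
Unshelve. all: by end_near. Qed.

Lemma takagi_le x : takagi x <= 2 / 3.
Proof.
apply: limr_le; first by apply: cvgP; exact: takagi_partial_cvg.
by near=> n; have [] := takagi_partial_le n x.
Unshelve. all: by end_near. Qed.

Lemma takagi_reflect x : takagi (1 - x) = takagi x.
Proof.
rewrite /takagi; congr (limn (series _)); apply/funext => n; congr *%R.
rewrite -(dist_int_reflect _ (2 ^+ n)); congr dist_int.
by rewrite rmorphXn/=; ring.
Qed.

Lemma takagi_half x : 0 <= x <= 1 / 2 -> takagi x = x + takagi (2 * x) / 2.
Proof.
move=> x01; have : S x n.+1 @[n --> \oo] --> takagi x.
  by rewrite (cvg_shiftS (S x)); exact: takagi_partial_cvg.
rewrite (_ : (fun n => S x n.+1) = (fun n => x + S (2 * x) n * 2^-1));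
  last first.
  by apply/funext => n /=; rewrite takagi_partialS dist_int_small.
move=> /cvg_lim <-//; apply/cvg_lim => //; apply: cvgD; first exact: cvg_cst.
by apply: cvgM; [exact: takagi_partial_cvg|exact: cvg_cst].
Qed.

Lemma takagi0 : takagi 0 = 0 :> R.
Proof.
have h : 0 <= (0 : R) <= 1 / 2 by lra.
by have := takagi_half h; rewrite mulr0; lra.
Qed.

Lemma takagi1 : takagi 1 = 0 :> R.
Proof. by rewrite -[1]subr0 takagi_reflect takagi0. Qed.

(** * Self-similarity and bounds of T on dyadic intervals *)

Lemma exp2V_gt0 k : 0 < 2 ^- k :> R.
Proof. by rewrite invr_gt0 exprn_gt0. Qed.

Lemma exp2V_le1 k : 2 ^- k <= 1 :> R.
Proof. by rewrite invf_le1 ?exprn_gt0// exprn_ege1// ler1n. Qed.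

Lemma exp2VS k : 2 ^- k.+1 = 2 ^- k / 2 :> R.
Proof. by rewrite exprSr invfM. Qed.

Lemma tE k : t R k = k%:R * 2 ^- k. Proof. by []. Qed.

Lemma takagi_exp2V k u : 0 <= u <= 1 ->
  takagi (2 ^- k * u) = 2 ^- k * (k%:R * u + takagi u).
Proof.
move=> u01; elim: k => [|k IH]; first by rewrite expr0 invr1 !mul1r mul0r add0r.
have := exp2V_gt0 k; have := exp2V_le1 k; rewrite exp2VS -[k.+1%:R]natr1.
set e := 2 ^- k in IH * => e1 e0; have eu : 0 <= e * u <= 1.
  by case/andP: u01 => u0 u1; rewrite mulr_ge0 ?mulr_ile1// ltW.
rewrite takagi_half; last by lra.
by rewrite (_ : 2 * _ = e * u) ?IH; field.
Qed.

(** The point is [2 ^- m] times 1 - (1 - w)/2; scaling, then reflection, then [takagi_half], then a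
    second reflection give the formula. *)
Lemma takagi_dyadic m w : 0 <= w <= 1 ->
  takagi (2 ^- m.+1 * (1 + w)) =
    2 ^- m.+1 * (m.+1%:R + (m%:R - 1) * w + takagi w).
Proof.
move=> w01; rewrite exp2VS -[m.+1%:R]natr1.
rewrite (_ : _ * (1 + w) = 2 ^- m * (1 - (1 - w) / 2)).
  rewrite takagi_exp2V; last by lra.
  rewrite takagi_reflect takagi_half; last by lra.
  by rewrite [2 * _]mulrC mulfVK// takagi_reflect; field.
by field.
Qed.

Lemma dyadic_coord m v : 2 ^- m.+1 <= v <= 2 ^- m ->
  exists2 w, 0 <= w <= 1 & v = 2 ^- m.+1 * (1 + w).
Proof.
rewrite exp2VS; have := exp2V_gt0 m; set e := 2 ^- m => e0 /andP[ev ve].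
exists (v / (e / 2) - 1); last by field; rewrite gt_eqF.
rewrite subr_ge0 lerBlDr ler_pdivlMr ?ler_pdivrMr ?divr_gt0//.
by apply/andP; split; lra.
Qed.

(** Induction over dyadic intervals: on each new one, m + 1 + (m - 1) w + T w < (m + 2)(1 + w),
    because T w <= 2/3 < 1. *)
Lemma takagi_lt_linear m k v : (m < k)%N -> 2 ^- m <= v <= 1 ->
  takagi v < k%:R * v.
Proof.
move=> mk; rewrite -(ltr_nat R) in mk.
elim: m mk => [|m IH] mk /andP[mv v1].
  rewrite expr0 invr1 in mv.
  have -> : v = 1 by apply/le_anti; rewrite v1.
  by rewrite takagi1 mulr1.
have [mv'|vm] := lerP (2 ^- m) v.
  by apply: IH; rewrite ?mv'// (lt_trans _ mk)// ltr_nat.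
have [w w01 ->] : exists2 w, 0 <= w <= 1 & v = 2 ^- m.+1 * (1 + w).
  by apply: dyadic_coord; rewrite mv ltW.
rewrite takagi_dyadic// mulrCA ltr_pM2l ?exp2V_gt0//.
have k2 : m%:R + 2 <= k%:R :> R by rewrite -natrD ler_nat addn2 -(ltr_nat R).
by have := takagi_le w; rewrite -[m.+1%:R]natr1; nra.
Qed.

(** This confines solutions of T x = y with y < t_k to the left of [2 ^- k]. On each dyadic interval
    in [0, 1/2] the slope in w is nonnegative, so T is at least its value at the left end. *)
Lemma t_le_takagi k x : (0 < k)%N -> 2 ^- k <= x <= 1 / 2 -> t R k <= takagi x.
Proof.
case: k => // k _; elim: k x => [|k IH] x /andP[kx x2].
  have -> : x = 1 / 2 by apply/le_anti; rewrite x2 -[2]expr1 mul1r.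
  rewrite takagi_half ?[2 * _]mulrC ?mulfVK ?takagi1//; last by lra.
  by rewrite /t expr1; lra.
have [kx'|xk] := lerP (2 ^- k.+1) x.
  by apply: le_trans (IH x _); [exact: t_nincr|rewrite kx'].
have [w w01 ->] : exists2 w, 0 <= w <= 1 & x = 2 ^- k.+2 * (1 + w).
  by apply: dyadic_coord; rewrite kx ltW.
rewrite takagi_dyadic// tE mulrC ler_pM2l ?exp2V_gt0//.
have := takagi_ge0 w; have : 0 <= k%:R :> R by [].
by rewrite -[k.+1%:R]natr1; nra.
Qed.

(** * Level sets of T w - 2 w *)

(* Written M(s) above. *)
Definition tilted_level s := [set w : R | 0 <= w <= 1 /\ takagi w - 2 * w = s].

Lemma takagi_quarter z : 0 <= z <= 1 -> takagi (z / 4) = z / 2 + takagi z / 4.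
Proof.
move=> z01; rewrite (_ : z / 4 = 2 ^- 2 * z); last by field.
by rewrite takagi_exp2V//; field.
Qed.

Lemma takagi_second_quarter z : 0 <= z <= 1 ->
  takagi ((1 + z) / 4) = 1 / 2 + takagi z / 4.
Proof.
move=> z01; rewrite (_ : _ / 4 = 2 ^- 2 * (1 + z)); last by field.
by rewrite takagi_dyadic//; field.
Qed.

(** As 2 w = T w - s <= 2/3, only the first two quarters matter. There T w - 2 w equals T z / 4 at w
    = z/4, and (T z - 2 z)/4 at w = (1 + z)/4. *)
Lemma tilted_levelE s : 0 <= s -> tilted_level s =
  (fun z => z / 4) @` L (4 * s) `|`
  (fun z => (1 + z) / 4) @` tilted_level (4 * s).
Proof.
move=> s0; apply/seteqP; split => [w [w01 ws]|_ [|] [z [z01 zs] <-]].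
- have w3 : w <= 1 / 3 by have := takagi_le w; lra.
  have [w4|w4] := lerP w (1 / 4).
    left; exists (4 * w); last by field.
    split; first by lra.
    have := @takagi_quarter (4 * w).
    by rewrite (_ : 4 * w / 4 = w); [move=> /(_ _); lra|field].
  right; exists (4 * w - 1); last by field.
  split; first by lra.
  have := @takagi_second_quarter (4 * w - 1).
  by rewrite (_ : (1 + (4 * w - 1)) / 4 = w); [move=> /(_ _); lra|field].
- by split; [lra|rewrite takagi_quarter//; lra].
- by split; [lra|rewrite takagi_second_quarter//; lra].
Qed.

Lemma counting_tilted_level s : 0 < s ->
  (counting (tilted_level s) =
    counting (L (4 * s)) + counting (tilted_level (4 * s)) :> \bar R)%E.
Proof.
move=> s0; apply: counting_split (tilted_levelE (ltW s0)).
- by move=> x y; lra.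
- by move=> x y; lra.
(* The copies meet only at 1/4, where z = 1 and T z = 0, against s > 0. *)
- move=> z w [z01 zs] [w01 ws] zw.
  by move: zs; rewrite (_ : z = 1) ?takagi1; lra.
Qed.

Lemma tilted_level0_infinite : infinite_set (tilted_level 0).
Proof.
(* The orbit of 0 under z |-> (1 + z) / 4, which maps M(0) to itself. *)
pose h n : R := (1 - 4^-1 ^+ n) / 3.
have h_inj : {in [set: nat] &, injective h}.
  move=> m n _ _ hmn; apply: (@ieexprIn R 4^-1) => //.
    by rewrite lt_eqF//; lra.
  by move: hmn; rewrite /h; lra.
have hsub : range h `<=` tilted_level 0.
  move=> _ [n _ <-]; elim: n => [|n [h01 hn]].
    by rewrite /h expr0 subrr mul0r; split; rewrite ?takagi0; lra.
  rewrite (_ : h n.+1 = (1 + h n) / 4); last by rewrite /h exprS; field.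
  by split; [lra|rewrite takagi_second_quarter//; lra].
move=> /(sub_finite_set hsub); rewrite (eq_finite_set (inj_card_eq h_inj)).
exact: infinite_nat.
Qed.

(** * Solutions of T x = y in [0, 2^-k] *)

Definition initial_level k y :=
  [set x : R | 0 <= x <= 2 ^- k /\ takagi x = y].

(** With e = 2^-k the point is e (1 - e z). Scaling by e, reflecting and scaling again produces the
    linear terms -k e z and k e z, which cancel. *)
Lemma takagi_left_of_exp2V k z : 0 <= z <= 1 ->
  takagi (2 ^- k - 4 ^- k * z) = t R k + 4 ^- k * takagi z.
Proof.
move=> z01; rewrite tE (natrM R 2 2) exprMn invfM.
have := exp2V_gt0 k; have := exp2V_le1 k.
have := takagi_exp2V k z01; have := @takagi_exp2V k (1 - 2 ^- k * z).
set e := 2 ^- k => Te Tz e1 e0.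
have ez : 0 <= e * z <= 1.
  by case/andP: z01 => z0 z1; rewrite mulr_ge0 ?mulr_ile1// ltW.
rewrite (_ : e - e * e * z = e * (1 - e * z)); last by ring.
by rewrite Te; [rewrite takagi_reflect Tz; ring|lra].
Qed.

(** Now [takagi_dyadic] supplies slope k - 2 against -k from the outer scaling, which leaves the
    tilt -2 w. *)
Lemma takagi_far_left_of_exp2V k w : (0 < k)%N -> 0 <= w <= 1 ->
  takagi (2 ^- k - 4 ^- k * (1 + w)) = t R k + 4 ^- k * (takagi w - 2 * w).
Proof.
case: k => // k _ w01; rewrite tE (natrM R 2 2) exprMn invfM.
have := takagi_dyadic k w01.
have := @takagi_exp2V k.+1 (1 - 2 ^- k.+1 * (1 + w)).
have : 0 <= 2 ^- k.+1 * (1 + w) <= 1.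
  rewrite exp2VS; have := exp2V_gt0 k; have := exp2V_le1 k.
  by case/andP: w01 => w0 w1 e1 e0; apply/andP; split; nra.
rewrite -[k.+1%:R]natr1; set e := 2 ^- k.+1 => ew Te Tw.
rewrite (_ : e - e * e * (1 + w) = e * (1 - e * (1 + w))); last by ring.
by rewrite Te; [rewrite takagi_reflect Tw; ring|lra].
Qed.

(** Put e = 2^-k and x = e (1 - v), so that the equation reads T v = k v + e s. Then v <= e gives a
    point of L(s), e < v <= 2 e gives one of M(s), and larger v are impossible. *)
Lemma initial_level_sub k s : (0 < k)%N -> 0 <= s ->
  initial_level k (t R k + 4 ^- k * s) `<=`
    (fun z => 2 ^- k - 4 ^- k * z) @` L s `|`
    (fun w => 2 ^- k - 4 ^- k * (1 + w)) @` tilted_level s.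
Proof.
move=> k0 s0 x [x01 xs].
have e0 := exp2V_gt0 k.
have [v xE] : exists v, x = 2 ^- k * (1 - v).
  by exists (1 - 2 ^+ k * x); rewrite subKr mulKf// gt_eqF// exprn_gt0.
have v01 : 0 <= v <= 1.
  case/andP: x01; rewrite xE pmulr_rge0// => v1.
  by rewrite -[leRHS]mulr1 ler_pM2l//; lra.
have vs : takagi v = k%:R * v + 2 ^- k * s.
  move: xs; rewrite xE takagi_exp2V; last by lra.
  rewrite takagi_reflect tE (natrM R 2 2) exprMn invfM => xs.
  by apply: (mulfI (lt0r_neq0 e0)); move: xs; lra.
rewrite (natrM R 2 2) exprMn invfM.
case: k k0 e0 xE vs {xs x01} => // k _ e0 xE vs.
have [ve|ev] := lerP v (2 ^- k.+1).
  have [z vz] : exists z, v = 2 ^- k.+1 * z.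
    by exists (2 ^+ k.+1 * v); rewrite mulKf// gt_eqF// exprn_gt0.
  have z01 : 0 <= z <= 1.
    case/andP: v01; rewrite vz pmulr_rge0// => z0 _.
    by move: ve; rewrite vz -[leRHS]mulr1 ler_pM2l//; lra.
  left; exists z; last by rewrite xE vz; ring.
  split=> //; apply: (mulfI (lt0r_neq0 e0)).
  by move: vs; rewrite vz takagi_exp2V//; lra.
have [w w01 vw] : exists2 w, 0 <= w <= 1 & v = 2 ^- k.+1 * (1 + w).
  (* Beyond [2 ^- k], which is 2 e after the shift of [k], T v < (k + 1) v, so s would be
     negative. *)
  apply: dyadic_coord; rewrite (ltW ev) leNgt; apply/negP => kv.
  have := @takagi_lt_linear k k.+1 v (ltnSn k).
  rewrite (ltW kv) => /(_ _); case/andP: v01 => _ -> /(_ isT).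
  by rewrite vs gtrDl pmulr_rlt0// ltNge s0.
right; exists w; last by rewrite xE vw; ring.
split=> //; apply: (mulfI (lt0r_neq0 e0)).
move: vs; rewrite vw takagi_dyadic// -[k.+1%:R]natr1.
by move: (2 ^- k.+1) => e; lra.
Qed.

Lemma initial_levelE k s : (0 < k)%N -> 0 <= s ->
  initial_level k (t R k + 4 ^- k * s) =
    (fun z => 2 ^- k - 4 ^- k * z) @` L s `|`
    (fun w => 2 ^- k - 4 ^- k * (1 + w)) @` tilted_level s.
Proof.
move=> k0 s0; have e40 : 0 < 4 ^- k :> R by rewrite invr_gt0 exprn_gt0.
apply/seteqP; split => [|_ [|] [z [z01 zs] <-]].
- exact: initial_level_sub.
- rewrite /initial_level/= takagi_left_of_exp2V// zs; split => //.
  rewrite (natrM R 2 2) exprMn invfM.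
  have := exp2V_gt0 k; have := exp2V_le1 k.
  by case/andP: z01 => z0 z1 e1 e0; apply/andP; split; nra.
- rewrite /initial_level/= takagi_far_left_of_exp2V// zs; split => //.
  rewrite (natrM R 2 2) exprMn invfM.
  (* With e <= 1/2, the point e - e^2 (1 + w) stays nonnegative up to w = 1. *)
  have := exp2V_gt0 k; have : 2 ^- k <= 1 / 2 :> R.
    case: k k0 {e40} => // k _; rewrite exp2VS.
    by have := exp2V_le1 k; lra.
  by case/andP: z01 => z0 z1 e1 e0; apply/andP; split; nra.
Qed.

Lemma counting_initial_level k s : (0 < k)%N -> 0 < s ->
  (counting (initial_level k (t R k + 4 ^- k * s)) =
    counting (L s) + counting (tilted_level s) :> \bar R)%E.
Proof.
move=> k0 s0; have e40 : 0 < 4 ^- k :> R by rewrite invr_gt0 exprn_gt0.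
have inj : injective (fun z : R => 2 ^- k - 4 ^- k * z).
  by move=> x y /addrI/oppr_inj/(mulfI (lt0r_neq0 e40)).
apply: counting_split (initial_levelE k0 (ltW s0)) => //.
- by move=> x y /inj/addrI.
- move=> z w [z01 zs] [w01 ws] /inj zw.
  by move: zs; rewrite (_ : z = 1) ?takagi1; lra.
Qed.

Lemma initial_level_infinite k : (0 < k)%N ->
  infinite_set (initial_level k (t R k)).
Proof.
move=> k0; have e40 : 0 < 4 ^- k :> R by rewrite invr_gt0 exprn_gt0.
have := initial_levelE k0 (lexx 0); rewrite mulr0 addr0 => ->.
rewrite finite_setU => -[_]; rewrite (eq_finite_set (inj_card_eq _)).
  exact: tilted_level0_infinite.
by move=> x y _ _ /addrI/oppr_inj/(mulfI (lt0r_neq0 e40))/addrI.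
Qed.

(** * Summing the counts over the scales 4^j *)

Local Open Scope ereal_scope.

Lemma L_large y : (2 / 3 < y)%R -> L y = set0.
Proof.
move=> y23; rewrite -subset0 => x [_ xy].
by have := takagi_le x; lra.
Qed.

Lemma tilted_level_large s : (2 / 3 < s)%R -> tilted_level s = set0.
Proof.
move=> y23; rewrite -subset0 => x [x01 xy].
by have := takagi_le x; lra.
Qed.

Lemma counting_level_iter n s : (0 < s)%R ->
  counting (L s) + counting (tilted_level s) =
    \sum_(0 <= j < n) counting (L (4 ^+ j * s)%R) +
    (counting (L (4 ^+ n * s)%R) + counting (tilted_level (4 ^+ n * s)%R))
    :> \bar R.
Proof.
move=> s0; elim: n => [|n ->]; first by rewrite big_geq// add0e expr0 mul1r.
rewrite big_nat_recr//= -addeA; congr (_ + (_ + _)).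
by rewrite counting_tilted_level ?mulrA -?exprS// mulr_gt0// exprn_gt0.
Qed.

Lemma exp4_unbounded s : (0 < s)%R -> exists n, (2 / 3 < 4 ^+ n * s)%R.
Proof.
(* For n > 1/s, 4^n s >= n s >= 1 > 2/3. *)
move=> s0; exists (Num.Def.archi_bound s^-1).
have s1 : (1 <= (Num.Def.archi_bound s^-1)%:R * s)%R.
  by rewrite -ler_pdivrMr// div1r ltW// archi_boundP// invr_ge0 ltW.
apply: lt_le_trans (_ : 1 <= _)%R; first by lra.
apply: le_trans s1 _; rewrite ler_pM2r// -natrX ler_nat.
by apply: ltnW; exact: ltn_expl.
Qed.

(** If s = 0, the left side is infinite and every term of the series is at least 1. If s > 0, the
    recursion is run until 4^n s > 2/3, where the remainder and all later terms vanish. *)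
Lemma counting_initial_levelE k s : (0 < k)%N -> (0 <= s)%R ->
  counting (initial_level k (t R k + 4 ^- k * s)%R) =
    \sum_(0 <= j <oo) counting (L (4 ^+ j * s)%R) :> \bar R.
Proof.
move=> k0; rewrite le_eqVlt => /predU1P[<-|s0].
  rewrite mulr0 addr0 counting_infinite; last exact: initial_level_infinite.
  apply/esym/eq_infty => r; pose n := Num.Def.archi_bound `|r|.
  apply: (@le_trans _ _ (\sum_(0 <= j < n) 1)).
    rewrite sumEFin sumr_const_nat subn0 lee_fin.
    by rewrite (le_trans (ler_norm r))// ltW// archi_boundP.
  apply: le_trans (nneseries_lim_ge n _); last by move=> *; exact: counting_ge0.
  apply: lee_sum => j _; rewrite mulr0.
  (* Isolating the solution 0 of T x = 0 bounds each term below by 1. *)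
  have L00 : L 0 = [set (0 : R)%R] `|` (L 0 `\ (0 : R)%R).
    by rewrite setD1K//; split; [rewrite lexx ler01|exact: takagi0].
  rewrite L00 counting_setU ?setDIK// -[leLHS]adde0 leeD ?counting_ge0//.
  by rewrite /counting asboolT// fset_set1 cardfs1.
have [n ns] := exp4_unbounded s0.
rewrite counting_initial_level// (counting_level_iter n)//.
rewrite L_large// tilted_level_large// counting0 !adde0.
rewrite (nneseries_split 0 n) ?add0n; last by move=> *; exact: counting_ge0.
rewrite (@eseries0 _ _ n) ?adde0// => j nj _.
rewrite L_large ?counting0// (lt_le_trans ns)// ler_pM2r//.
by rewrite ler_weXn2l// ler1n.
Qed.

(* Decompositions of L_0(y) and L(y) *)
Local Close Scope ereal_scope.

Lemma L0E y : L0 y = initial_level 1 y.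
Proof.
rewrite /initial_level expr1 -[2^-1]mul1r.
apply/seteqP; split=> [x [[_ xy] x2]//|x [x2 xy]].
by do 2!split=> //; lra.
Qed.

(** For x = 2^-k w, both [takagi_exp2V] at x and [takagi_dyadic] at the shifted point have slope k
    in w, so the linear terms agree. *)
Lemma takagi_right_of_exp2V k x : 0 <= x <= 2 ^- k ->
  takagi (2 ^- k.+2 + x / 4) = t R k.+2 + takagi x / 4.
Proof.
have e0 := exp2V_gt0 k; move=> xk.
have [w xw] : exists w, x = 2 ^- k * w.
  by exists (2 ^+ k * x); rewrite mulKf// gt_eqF// exprn_gt0.
have w01 : 0 <= w <= 1.
  case/andP: xk; rewrite xw pmulr_rge0// => w0.
  by rewrite -[leRHS]mulr1 ler_pM2l//; lra.
rewrite xw takagi_exp2V// (_ : _ + _ = 2 ^- k.+2 * (1 + w)).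
  rewrite takagi_dyadic// tE !exp2VS -[k.+2%:R]natr1 -[k.+1%:R]natr1.
  by move: (2 ^- k) => e; field.
by rewrite !exp2VS; field.
Qed.

Lemma L0_split k y : (3 <= k)%N -> I k y ->
  L0 y = initial_level k y `|` (fun x => 2 ^- k + x / 4) @` L0 (Psi y).
Proof.
move=> k3 ky; rewrite (PsiE (ltnW k3) ky).
move: ky; rewrite /I gtn_eqF//= => /andP[].
case: k k3 => [//|[//|[//|k]]] k1 /=.
have e0 := exp2V_gt0 k.+3.
have e4 : 2 ^- k.+1 = 4 * 2 ^- k.+3 :> R by rewrite !exp2VS; field.
have e2 : 2 ^- k.+2 = 2 * 2 ^- k.+3 :> R by rewrite !exp2VS; field.
have eh : 2 ^- k.+1 <= 1 / 2 :> R.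
  by rewrite exp2VS; have := exp2V_le1 k; lra.
(* With [k.+3] as the index of y, this identity turns y < t_{k+2} into Psi(y) < t_{k+1}, so
   solutions for Psi(y) stay below [2 ^- k.+1], in the range of [takagi_right_of_exp2V]. *)
have tt : 4 * (t R k.+2 - t R k.+3) = t R k.+1.
  rewrite !tE e2 e4 -[k.+3%:R]natr1 -[k.+2%:R]natr1.
  by move: (2 ^- k.+3) => e; ring.
move=> ty yt; apply/seteqP; split => [x [[x01 xy] /= x2]|x [|]].
- have [xk|kx] := lerP x (2 ^- k.+3); first by left; split=> //; lra.
  right; exists (4 * (x - 2 ^- k.+3)); last by field.
  have xk1 : x < 2 ^- k.+2.
    rewrite ltNge; apply/negP => kx1.
    have : t R k.+2 <= takagi x by apply: t_le_takagi => //; lra.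
    by rewrite xy; lra.
  have xk : 0 <= 4 * (x - 2 ^- k.+3) <= 2 ^- k.+1 by lra.
  have := takagi_right_of_exp2V xk.
  rewrite (_ : 4 * _ / 4 = x - 2 ^- k.+3); last by field.
  rewrite addrC subrK xy => Ty.
  by split; [split|rewrite /=]; lra.
- by move=> [xk xy]; split; [split=> //|rewrite /=]; lra.
- move=> [z [[z01 zy] /= z2] <-].
  have zk : 0 <= z <= 2 ^- k.+1.
    have [zk|kz] := lerP z (2 ^- k.+1); first by lra.
    have : t R k.+1 <= takagi z by apply: t_le_takagi => //; lra.
    by rewrite zy; lra.
  by split; [split; [|rewrite takagi_right_of_exp2V// zy]|rewrite /=]; lra.
Qed.

Lemma L_split y : L y = L0 y `|` (fun x => 1 - x) @` L0 y.
Proof.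
apply/seteqP; split => [x [x01 xy]|x [[]//|[z [[z01 zy] z2] <-]]].
  have [x2|x2] := lerP x (1 / 2); [left|right].
    by split; [split|rewrite /=; lra].
  exists (1 - x); last by ring.
  by split; [split; [lra|rewrite takagi_reflect]|rewrite /=; lra].
by split; [lra|rewrite takagi_reflect].
Qed.

Lemma t1E : t R 1 = 1 / 2.
Proof. by rewrite /t expr1. Qed.

(** The two halves share only x = 1/2, hence only when y = T(1/2) = 1/2 = t_1, and that level set is
    infinite. *)
Lemma counting_L y :
  (counting (L y) = 2%:E * counting (L0 y) :> \bar R)%E.
Proof.
have [->|y2] := eqVneq y (1 / 2).
  have iL : infinite_set (L0 (1 / 2 : R)).
    by rewrite L0E -t1E; exact: initial_level_infinite.
  rewrite [counting (L0 _)]counting_infinite// counting_infinite.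
    by rewrite gt0_muley ?lte_fin.
  by rewrite L_split finite_setU => -[].
rewrite mule_natl mule2n; have := L_split y.
rewrite -[X in X `|` _]image_id => LE.
apply: counting_split LE => [||x z].
- exact: inj_id.
- by move=> u v; lra.
- move=> [[_ xy] /= x2] [_ /= z2] xz.
  have h : 0 <= (1 / 2 : R) <= 1 / 2 by lra.
  have := takagi_half h; rewrite (_ : 2 * (1 / 2) = 1) ?takagi1; last by field.
  by move=> T2; move/eqP: y2; apply; rewrite -xy (_ : x = 1 / 2); lra.
Qed.

(** The pieces can meet only at 2^-k, where T is t_k; for y = t_k both sides are infinite. *)
Lemma counting_L0_split k y : (3 <= k)%N -> I k y ->
  (counting (L0 y) =
    counting (L0 (Psi y)) + counting (initial_level k y) :> \bar R)%E.
Proof.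
move=> k3 ky; have LE := L0_split k3 ky.
have k0 : (0 < k)%N by apply: leq_trans k3.
have [yt|yt] := eqVneq y (t R k).
  have iD : infinite_set (initial_level k y).
    by rewrite yt; exact: initial_level_infinite.
  rewrite [counting (initial_level _ _)]counting_infinite//.
  rewrite addey; last by rewrite gt_eqF// (lt_le_trans _ (counting_ge0 _)).
  by rewrite counting_infinite// LE finite_setU => -[].
rewrite addeC; move: LE; rewrite -[X in X `|` _]image_id => LE.
apply: counting_split LE => [||x z].
- exact: inj_id.
- by move=> u v; lra.
- move=> [xk xy] [_ /= z2] xz; move/eqP: yt; apply.
  rewrite -xy (_ : x = 2 ^- k * 1); last by lra.
  by rewrite takagi_exp2V ?takagi1 ?mulr1 ?addr0 1?mulrC//; lra.
Qed.

End takagi.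

Local Open Scope ereal_scope.

Theorem corollary3p2 (R : realType) :
  (forall y : R, (0 <= y)%R ->
     counting (L y) = 2%:E * counting (L0 y) :> \bar R)
  /\ (forall (y : R) (k : nat), (3 <= k)%N -> I k y ->
     counting (L0 y) =
       counting (L0 (Psi y))
         + \sum_(0 <= j <oo) counting (L (4 ^+ j * Phi y)%R) :> \bar R)
  /\ (forall y : R, I 2 y ->
     counting (L0 y) =
       \sum_(0 <= j <oo) counting (L (4 ^+ j * Phi y)%R) :> \bar R).
Proof.
split; [|split] => [y _|y k k3 ky|y ky].
- exact: counting_L.
- have k0 : (0 < k)%N by apply: leq_trans k3.
  rewrite (counting_L0_split k3 ky) -(counting_initial_levelE k0).
    by rewrite (PhiE k3 ky) mulKf ?subrKC// gt_eqF// exprn_gt0.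
  by rewrite (PhiE k3 ky) mulr_ge0 ?exprn_ge0// subr_ge0 I_ge.
- have y2 : (1 / 2 <= y)%R by case/andP: ky.
  (* Since t_1 = t_2 = 1/2, the index 1 is usable on I_2, and its factor 4^1 matches Phi there. *)
  rewrite -(@counting_initial_levelE R 1)// Phi_ge_half//; last by lra.
  by rewrite L0E t1E expr1 mulKf ?subrKC// gt_eqF.
Qed.
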